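(* Every real Clifford algebra $\mathrm{Cl}(p,q)$ ($p,q\ge0$ integers) has a basis of one-vectors $\mathbf{B}=\{V_1,\dots,V_{p+q}\}$, consisting of matrices with entries in $\mathbf{R}$, $\mathbf{C}$ or $\mathbf{H}$, with the following two properties: (BP1) $V_i^{*}=\pm V_i$ for every $i$ (the sign may depend on $i$); (BP2) for all $U,V\in\mathbf{B}$ with $U\neq V$: $\mathrm{Tr}(U^{*}V)=0$ if $\mathbf{B}$ consists of real or complex matrices, and $\mathrm{Re}(\mathrm{Tr}(U^{*}V))=0$ if $\mathbf{B}$ contains quaternionic matrices.
   Context: $X^{*}$ denotes conjugate transpose (complex or quaternionic conjugation entrywise, then transposition). A basis of one-vectors for $\mathrm{Cl}(p,q)$, $n=p+q$, is a collection of square matrices $X_1,\dots,X_n$ of the same size, with entries in $\mathbf{R}$, $\mathbf{C}$ or $\mathbf{H}$, such that $X_i^2=I$ for $1\le i\le p$, $X_i^2=-I$ for $p+1\le i\le n$, $X_iX_j=-X_jX_i$ for $i\ne j$, and such that the real algebra they generate is (isomorphic to) the Clifford algebra $\mathrm{Cl}(p,q)$, of real dimension $2^{n}$. *)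

(* Defs.v *)
From HB Require Import structures.
From mathcomp Require Import all_boot all_order all_algebra all_field.
From mathcomp Require Import ring.
From mathcomp Require Import complex.
From mathcomp Require Import reals.

Set Implicit Arguments.
Unset Strict Implicit.
Unset Printing Implicit Defensive.

Import Order.TTheory GRing.Theory Num.Theory.
Local Open Scope ring_scope.

(* [Quaternion a b c d] is a + b i + c j + d k. *)
Record quaternion (R : Type) : Type :=
  Quaternion { qre : R; qi : R; qj : R; qk : R }.

Definition quaternion_to (R : Type) (x : quaternion R) :=
  (qre x, qi x, qj x, qk x).
Definition quaternion_of (R : Type) (t : R * R * R * R) :=
  let: (a, b, c, d) := t in Quaternion a b c d.

Lemma quaternion_toK (R : Type) :
  cancel (@quaternion_to R) (@quaternion_of R).
Proof. by case. Qed.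

HB.instance Definition _ (R : choiceType) :=
  Choice.copy (quaternion R) (can_type (@quaternion_toK R)).

Section QuaternionRing.
Variable R : comNzRingType.
Implicit Types x y z : quaternion R.

Definition addq x y :=
  Quaternion (qre x + qre y) (qi x + qi y) (qj x + qj y) (qk x + qk y).
Definition oppq x := Quaternion (- qre x) (- qi x) (- qj x) (- qk x).
Definition mulq x y :=
  let: Quaternion a b c d := x in
  let: Quaternion a' b' c' d' := y in
  Quaternion (a * a' - b * b' - c * c' - d * d')
             (a * b' + b * a' + c * d' - d * c')
             (a * c' - b * d' + c * a' + d * b')
             (a * d' + b * c' - c * b' + d * a').
Definition real_quaternion (a : R) := Quaternion a 0 0 0.
Definition conjq x := Quaternion (qre x) (- qi x) (- qj x) (- qk x).
(* The copy of C inside the quaternions is R + R i. *)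
Definition complex_quaternion x := (qj x == 0) && (qk x == 0).

Fact addqA : associative addq.
Proof. by move=> [????] [????] [????]; rewrite /addq /= !addrA. Qed.
Fact addqC : commutative addq.
Proof. by move=> [a b c d] [????]; congr Quaternion; rewrite addrC. Qed.
Fact add0q : left_id (real_quaternion 0) addq.
Proof. by move=> [a b c d]; rewrite /addq /= !add0r. Qed.
Fact addNq : left_inverse (real_quaternion 0) oppq addq.
Proof. by move=> [a b c d]; rewrite /addq /= !addNr. Qed.

HB.instance Definition _ :=
  GRing.isZmodule.Build (quaternion R) addqA addqC add0q addNq.

Fact mulqA : associative mulq.
Proof. by move=> [????] [????] [????]; congr Quaternion; ring. Qed.
Fact mul1q : left_id (real_quaternion 1) mulq.
Proof. by move=> [????]; congr Quaternion; ring. Qed.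
Fact mulq1 : right_id (real_quaternion 1) mulq.
Proof. by move=> [????]; congr Quaternion; ring. Qed.
Fact mulqDl : left_distributive mulq addq.
Proof. by move=> [????] [????] [????]; congr Quaternion => /=; ring. Qed.
Fact mulqDr : right_distributive mulq addq.
Proof. by move=> [????] [????] [????]; congr Quaternion => /=; ring. Qed.
Fact oneq_neq0 : real_quaternion 1 != real_quaternion 0.
Proof. by apply/eqP => -[] /eqP; rewrite oner_eq0. Qed.

HB.instance Definition _ :=
  GRing.Zmodule_isNzRing.Build (quaternion R)
    mulqA mul1q mulq1 mulqDl mulqDr oneq_neq0.

Fact real_quaternion_is_zmod_morphism : zmod_morphism real_quaternion.
Proof. by move=> a b; congr Quaternion => /=; ring. Qed.
Fact real_quaternion_is_monoid_morphism : monoid_morphism real_quaternion.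
Proof. by split=> // a b; congr Quaternion => /=; ring. Qed.

HB.instance Definition _ :=
  GRing.isZmodMorphism.Build R (quaternion R)
    real_quaternion real_quaternion_is_zmod_morphism.
HB.instance Definition _ :=
  GRing.isMonoidMorphism.Build R (quaternion R)
    real_quaternion real_quaternion_is_monoid_morphism.

End QuaternionRing.

Definition adjmx (D : Type) (conj : D -> D) (m n : nat)
    (A : 'M[D]_(m, n)) : 'M[D]_(n, m) :=
  map_mx conj A^T.

Definition clifford_relations (p q : nat) (A : nzRingType)
    (e : 'I_(p + q) -> A) : Prop :=
  (forall i, e i * e i = if (i < p)%N then 1 else -1) /\
  (forall i j, i != j -> e i * e j = - (e j * e i)).

(* (A, e) is Cl(p, q) with its canonical generators: A is the universal unital
   real algebra on generators satisfying the Clifford relations. *)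
Definition is_clifford_algebra (R : realType) (p q : nat) (A : falgType R)
    (e : 'I_(p + q) -> A) : Prop :=
  [/\ clifford_relations e,
      \dim {: A} = (2 ^ (p + q))%N &
      forall (B : algType R) (w : 'I_(p + q) -> B), clifford_relations w ->
        exists f : {lrmorphism A -> B},
          (forall i, f (e i) = w i) /\
          (forall g : {lrmorphism A -> B}, (forall i, g (e i) = w i) -> g =1 f)].

Section OneVectors.
(* D stands for R, C or H, regarded as a real algebra through [emb]. *)
Variables (R : realType) (D : nzRingType) (emb : {rmorphism R -> D}).
Variables (p q m : nat).

Inductive generated_real_algebra (X : 'I_(p + q) -> 'M[D]_m.+1) :
    'M[D]_m.+1 -> Prop :=
| GenOne : generated_real_algebra X 1
| GenVar i : generated_real_algebra X (X i)
| GenScale (a : R) M :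
    generated_real_algebra X M -> generated_real_algebra X (emb a *: M)
| GenAdd M N : generated_real_algebra X M -> generated_real_algebra X N ->
    generated_real_algebra X (M + N)
| GenMul M N : generated_real_algebra X M -> generated_real_algebra X N ->
    generated_real_algebra X (M *m N).

(* f is a real algebra isomorphism from Cl(p, q) onto the real algebra generated
   by the X i; its scaling law says f (a *: x) = emb a *: f x for a in R. *)
Definition one_vector_basis (X : 'I_(p + q) -> 'M[D]_m.+1) : Prop :=
  clifford_relations X /\
  exists (A : falgType R) (e : 'I_(p + q) -> A)
         (f : {lrmorphism A -> 'M[D]_m.+1 | emb \; *:%R}),
    [/\ is_clifford_algebra e,
        forall i, f (e i) = X i,
        injective f &
        forall M, generated_real_algebra X M <-> exists a, f a = M].

End OneVectors.

(* Main.v *)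
(* Cl(p, q) is realised by its left regular representation on the ordered
   monomials e_S, S a set of indices. Each generator permutes the monomials up to
   sign, so its matrix is a signed permutation matrix, whose transpose is its
   inverse +-(itself). For i <> j the product X_i X_j is minus X_j X_i, so its
   trace vanishes. The monomials in the X_i send e_set0 = 1 to the distinct
   basis vectors e_S, so they are linearly independent; as the rule for X_i X_S only
   uses the Clifford relations, their span has the universal property. *)

From HB Require Import structures.
Require Import Defs.
From mathcomp Require Import all_boot all_order all_algebra all_field.
From mathcomp Require Import complex reals.

Set Implicit Arguments.
Unset Strict Implicit.
Unset Printing Implicit Defensive.

Import Order.TTheory GRing.Theory Num.Theory.
Local Open Scope ring_scope.
Local Open Scope complex_scope.

(** * Ordered monomials in Clifford generators and their sign rule *)

Section Monomials.
Variables p q : nat.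
Local Notation n := (p + q)%N.
Implicit Types (i j : 'I_n) (S T : {set 'I_n}) (s : seq 'I_n).

(** Symmetric difference with the singleton of [i], written as an exclusive or so that its laws are
    those of [addb]. *)
Definition toggle i S := [set j | (j \in S) (+) (j == i)].

Lemma in_toggle i j S : (j \in toggle i S) = (j \in S) (+) (j == i).
Proof. by rewrite inE. Qed.

Lemma toggleK i : involutive (toggle i).
Proof. by move=> S; apply/setP=> j; rewrite !in_toggle addbK. Qed.

Lemma toggleC i j S : toggle i (toggle j S) = toggle j (toggle i S).
Proof. by apply/setP=> k; rewrite !in_toggle addbAC. Qed.

(* Left multiplication by e_i sends the ordered monomial e_S to
   (-1)^(monomial_sign i S) e_(toggle i S): e_i moves past the generators e_j
   with j in S and j < i, and if i lies in S it is absorbed by e_i^2. *)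
Definition monomial_sign i S : bool :=
  \big[addb/false]_(j < n | (j < i)%N) (j \in S) (+) ((i \in S) && (p <= i)%N).

(** The parity is additive under symmetric difference, so only the contribution of [j] matters: it
    counts when [j] lies below [i], or when [j] is [i] and the square of [e_i] is -1. *)
Lemma monomial_sign_toggle i j S :
  monomial_sign i (toggle j S) =
    monomial_sign i S (+) (if i == j then (p <= i)%N else (j < i)%N).
Proof.
rewrite /monomial_sign in_toggle (eq_bigr _ (fun k _ => in_toggle j k S)).
rewrite big_split /=.
have -> : \big[addb/false]_(k < n | (k < i)%N) (k == j) = (j < i)%N.
  case: ltnP => [lt_ji|le_ij].
    by rewrite (bigD1 j) //= eqxx big1 // => k /andP[_ /negbTE].
  by rewrite big1 // => k; apply: contraTF => /eqP->; rewrite -leqNgt.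
case: eqVneq => [->|_]; rewrite ?ltnn ?addbF.
  by case: (j \in S); case: (p <= j)%N; rewrite ?addbT ?addbF ?negbK.
by rewrite addbAC.
Qed.

Definition monomial (A : nzRingType) (e : 'I_n -> A) S : A :=
  \prod_(i < n | i \in S) e i.

Lemma sorted_index_enum : sorted (fun i j => i < j)%N (index_enum 'I_n).
Proof.
by have:= iota_ltn_sorted 0 n; rewrite -val_enum_ord sorted_map
  enumT /index_enum unlock.
Qed.

(** Induction along the increasing enumeration of indices. As only the Clifford relations enter, the
    same rule serves the matrices [reg_mx] and the generators of any target algebra. *)
Lemma mul_monomial (A : nzRingType) (e : 'I_n -> A) i S :
  clifford_relations e ->
  e i * monomial e S = (-1) ^+ monomial_sign i S * monomial e (toggle i S).
Proof.
move=> [sqr_e anti_e]; rewrite /monomial_sign /monomial.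
have: i \in index_enum 'I_n by rewrite mem_index_enum.
elim: (index_enum _) sorted_index_enum => // a s IH a_s.
rewrite in_cons !big_cons in_toggle.
(* If [i] heads the list, all later indices are larger: they give no sign and toggling leaves them
   alone. Otherwise [e_i] first crosses [e_a], at the cost of one sign if [a] is in [S]. *)
have [->{i IH} _|ia /= i_s] := eqVneq i a.
  rewrite ltnn.
  have gt_a j : j \in s -> (a < j)%N.
    by move=> js; apply: (allP (order_path_min _ a_s)) => // ? ? ?;
      apply: ltn_trans.
  have -> : \big[addb/false]_(j <- s | (j < a)%N) (j \in S) = false.
    rewrite big_seq_cond big_pred0 // => j.
    by apply/andP=> -[/gt_a]; rewrite ltnNge => /negP ltNa /ltnW.
  have -> : \prod_(j <- s | j \in toggle a S) e j =
      \prod_(j <- s | j \in S) e j.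
    rewrite [LHS]big_seq_cond [RHS]big_seq_cond; apply: eq_bigl => j.
    case: (boolP (j \in s)) => //= /gt_a; rewrite ltn_neqAle => /andP[ne_aj _].
    by rewrite in_toggle -val_eqE eq_sym (negbTE ne_aj) addbF.
  rewrite addbT addFb /=.
  case: (a \in S) => /=; rewrite ?mul1r //.
  rewrite mulrA sqr_e ltnNge.
  by case: (p <= a)%N; rewrite /= ?expr1 ?expr0.
have lt_ai : (a < i)%N.
  by apply: (allP (order_path_min _ a_s)) => // ? ? ?; apply: ltn_trans.
rewrite lt_ai addbF.
have {}IH := IH (path_sorted a_s) i_s.
case: (a \in S); rewrite ?addFb //.
rewrite mulrA anti_e // mulNr -mulrA IH -addbA addTb signrN mulNr; congr (- _).
by rewrite !mulr_sign; case: ifP; rewrite ?mulrN.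
Qed.

Lemma monomial1 (A : nzRingType) (e : 'I_n -> A) i : monomial e [set i] = e i.
Proof.
by rewrite /monomial (eq_bigl (pred1 i)) ?big_pred1_eq // => j; rewrite inE.
Qed.

Lemma monomial0 (A : nzRingType) (e : 'I_n -> A) : monomial e set0 = 1.
Proof. by rewrite /monomial big_pred0 // => j; rewrite inE. Qed.
End Monomials.

(** * Signed permutation matrices of the left regular representation *)

Section LeftRegular.
Variables (R : realType) (p q : nat).
Local Notation n := (p + q)%N.
Implicit Types (i j : 'I_n) (S T : {set 'I_n}).

Definition reg_size : nat := #|{set 'I_n}|.-1.

Lemma reg_sizeE : #|{set 'I_n}| = reg_size.+1.
Proof. by rewrite /reg_size prednK //; apply/card_gt0P; exists set0. Qed.

Definition set_index S : 'I_reg_size.+1 := cast_ord reg_sizeE (enum_rank S).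
Definition index_set (r : 'I_reg_size.+1) : {set 'I_n} :=
  enum_val (cast_ord (esym reg_sizeE) r).

Lemma set_indexK : cancel set_index index_set.
Proof. by move=> S; rewrite /index_set /set_index cast_ordK enum_rankK. Qed.

Lemma index_setK : cancel index_set set_index.
Proof. by move=> r; rewrite /index_set /set_index enum_valK cast_ordKV. Qed.

Definition reg_mx i : 'M[R]_reg_size.+1 :=
  \matrix_(r, c) ((-1) ^+ monomial_sign i (index_set c) *+
                  (index_set r == toggle i (index_set c))).

Definition basis_vec S : 'cV[R]_reg_size.+1 := delta_mx (set_index S) 0.

Lemma reg_mx_basis i S :
  reg_mx i *m basis_vec S = (-1) ^+ monomial_sign i S *: basis_vec (toggle i S).
Proof.
rewrite -colE; apply/matrixP=> r c; rewrite !mxE set_indexK ord1 eqxx andbT.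
by rewrite -(can_eq index_setK) set_indexK mulr_natr.
Qed.

Lemma basis_vec_inj (M N : 'M[R]_reg_size.+1) :
  (forall S, M *m basis_vec S = N *m basis_vec S) -> M = N.
Proof.
move=> eqMN; apply/matrixP=> r c.
have /matrixP/(_ r 0) := eqMN (index_set c).
by rewrite /basis_vec index_setK -!colE !mxE.
Qed.

(** As [toggle i] is an involution, transposition preserves the support; the signs at [S] and
    [toggle i S] differ by the sign of the square of [e_i]. *)
Lemma reg_mx_tr i : (reg_mx i)^T = (-1) ^+ (p <= i)%N *: reg_mx i.
Proof.
apply/matrixP=> r c; rewrite !mxE.
rewrite -[in LHS](inv_eq (@toggleK p q i)) eq_sym.
case: eqP => [->|_]; last by rewrite mulr0.
by rewrite monomial_sign_toggle eqxx signr_addb mulrC.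
Qed.

Lemma reg_mx_clifford : clifford_relations reg_mx.
Proof.
split=> [i|i j ij]; apply: basis_vec_inj => S.
  rewrite -mulmxE -mulmxA reg_mx_basis -scalemxAr reg_mx_basis scalerA toggleK.
  rewrite monomial_sign_toggle eqxx signr_addb mulrA -expr2 sqrr_sign mul1r.
  by rewrite leqNgt; case: (i < p)%N; rewrite ?mul1mx ?scale1r //
    mulNmx mul1mx scaleN1r.
rewrite mulNmx -!mulmxE -!mulmxA !reg_mx_basis -!scalemxAr.
rewrite !reg_mx_basis !scalerA toggleC -scaleNr -!signr_addb -signrN.
congr ((-1) ^+ nat_of_bool _ *: _).
rewrite !monomial_sign_toggle (negbTE ij) eq_sym (negbTE ij).
(* Exactly one of the two orders of multiplication picks up an extra sign. *)
have -> : (j < i)%N = ~~ (i < j)%N.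
  by case: ltngtP ij => // /val_inj ->; rewrite eqxx.
by case: ltnP; case: (monomial_sign i S); case: (monomial_sign j S).
Qed.

Lemma reg_mx_trace i j : i != j -> \tr ((reg_mx i)^T *m reg_mx j) = 0.
Proof.
move=> ij; rewrite reg_mx_tr -scalemxAl mxtraceZ.
have /eqP : \tr (reg_mx i *m reg_mx j) = - \tr (reg_mx i *m reg_mx j).
  by rewrite {1}mulmxE (reg_mx_clifford.2 i j ij) raddfN /= mxtrace_mulC.
by rewrite eq_sym eqNr => /eqP->; rewrite mulr0.
Qed.

(** The factors act from the largest index down, so each generator meets a set of strictly larger
    indices and contributes no sign. *)
Lemma monomial_reg_basis S :
  monomial (reg_mx : _ -> 'M[R]_reg_size.+1) S *m basis_vec set0 = basis_vec S.
Proof.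
(* Restricting [S] to the enumerated list gives a statement that can be proved by induction on that
   list. *)
transitivity (basis_vec [set j in index_enum 'I_n | j \in S]); last first.
  by congr basis_vec; apply/setP=> j; rewrite inE mem_index_enum.
rewrite /monomial.
elim: (index_enum _) (sorted_index_enum p q) => [_|a s IH a_s].
  by rewrite big_nil mul1mx; congr basis_vec; apply/setP=> j; rewrite !inE.
have a_lt : {in s, forall j : 'I_n, (a < j)%N}.
  by apply/allP; apply: (order_path_min _ a_s) => ? ? ?; apply: ltn_trans.
have {}IH := IH (path_sorted a_s).
have a_s' : a \notin s by apply/negP => /a_lt; rewrite ltnn.
rewrite big_cons; case: ifP => aS.
  rewrite -mulmxE -mulmxA [X in _ *m X]IH reg_mx_basis.
  rewrite /monomial_sign inE (negbTE a_s') /= addbF big1 ?scale1r => [|j lt_ja].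
    congr basis_vec; apply/setP=> j; rewrite !inE.
    by have [->|_] := eqVneq j a; rewrite ?(negbTE a_s') ?aS ?addbF.
  by rewrite inE; apply/andP=> -[/a_lt]; rewrite ltnNge (ltnW lt_ja).
rewrite IH; congr basis_vec; apply/setP=> j; rewrite !inE.
by have [->|_] := eqVneq j a; rewrite ?(negbTE a_s') ?aS.
Qed.
End LeftRegular.

(** * The span of the monomial matrices as a model of Cl(p, q) *)

Section RegularAlgebra.
Variables (R : realType) (p q : nat).
Local Notation n := (p + q)%N.
Local Notation N := (reg_size p q).+1.
Local Notation reg := (@reg_mx R p q).
Implicit Types (i j : 'I_n) (S T : {set 'I_n}).

Lemma monomial_reg_entry S T :
  monomial reg S (set_index T) (set_index set0) = (T == S)%:R.
Proof.
have /matrixP/(_ (set_index T) 0) := monomial_reg_basis R S.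
by rewrite -colE !mxE (can_eq (@set_indexK p q)) andbT.
Qed.

Definition monomials : N.-tuple 'M[R]_N :=
  [tuple monomial reg (index_set r) | r < N].

Definition reg_span : {vspace 'M[R]_N} := <<monomials>>%VS.

Lemma nth_monomials (r : 'I_N) : monomials`_r = monomial reg (index_set r).
Proof. by rewrite -tnth_nth tnth_mktuple. Qed.

Lemma monomials_entry (r s : 'I_N) :
  monomials`_r s (set_index set0) = (s == r)%:R.
Proof.
rewrite nth_monomials -{1}(index_setK s) monomial_reg_entry.
by rewrite (can_eq (@index_setK p q)).
Qed.

Lemma free_monomials : free monomials.
Proof.
apply/freeP => k k0 r.
have /matrixP/(_ r (set_index set0)) := k0.
rewrite summxE (bigD1 r) //= big1 => [|s sr]; rewrite !mxE monomials_entry.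
  by rewrite eqxx mulr1 addr0.
by rewrite eq_sym (negbTE sr) mulr0.
Qed.

Lemma dim_reg_span : \dim reg_span = (2 ^ n)%N.
Proof.
have:= free_monomials; rewrite /free size_tuple => /eqP->.
by rewrite -reg_sizeE -cardsT -powersetT card_powerset cardsT card_ord.
Qed.

Lemma monomial_in_span S : monomial reg S \in reg_span.
Proof.
rewrite -(set_indexK S) -nth_monomials memv_span //.
by rewrite mem_nth // size_tuple.
Qed.

(** The column at [set0] of each monomial is a basis vector, so this column of [M] lists the
    coordinates of [M]. *)
Lemma reg_span_eq M : M \in reg_span ->
  M = \sum_S M (set_index S) (set_index set0) *: monomial reg S.
Proof.
move=> /coord_span MP.
have coordE r : M r (set_index set0) = coord monomials r M.
  rewrite [in LHS]MP summxE (bigD1 r) //= big1 => [|s sr].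
    by rewrite !mxE monomials_entry eqxx mulr1 addr0.
  by rewrite !mxE monomials_entry eq_sym (negbTE sr) mulr0.
rewrite [LHS]MP (reindex (@set_index p q)); last first.
  by exists (@index_set p q) => r _; rewrite ?set_indexK ?index_setK.
by apply: eq_bigr => S _; rewrite nth_monomials set_indexK coordE.
Qed.

Lemma reg_span_ind (P : 'M[R]_N -> Prop) :
  P 0 -> (forall M M', P M -> P M' -> P (M + M')) ->
  (forall a M, P M -> P (a *: M)) -> (forall S, P (monomial reg S)) ->
  forall M, M \in reg_span -> P M.
Proof.
move=> P0 PD PZ Pm M /reg_span_eq ->.
by elim/big_ind: _ => // S _; apply: PZ.
Qed.

(** By the sign rule a generator sends monomials to signed monomials; iterating over the factors of
    a monomial then gives closure under products. *)
Lemma mul_reg_span i M : M \in reg_span -> reg i * M \in reg_span.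
Proof.
move: M; apply: reg_span_ind => [|M M' ? ?|a M ?|S].
- by rewrite mulr0 mem0v.
- by rewrite mulrDr memvD.
- by rewrite -scalerAr memvZ.
rewrite mul_monomial; last exact: reg_mx_clifford.
by rewrite mulr_sign; case: ifP; rewrite ?memvN monomial_in_span.
Qed.

Lemma reg_span_mul M M' :
  M \in reg_span -> M' \in reg_span -> M * M' \in reg_span.
Proof.
move=> + M'U; move: M; apply: reg_span_ind => [|M1 M2 ? ?|a M ?|S].
- by rewrite mul0r mem0v.
- by rewrite mulrDl memvD.
- by rewrite -scalerAl memvZ.
rewrite /monomial; elim/big_rec: _ => [|i M _ ?]; first by rewrite mul1r.
by rewrite -mulrA mul_reg_span.
Qed.

Lemma reg_span1 : 1 \in reg_span.
Proof. by rewrite -(monomial0 reg) monomial_in_span. Qed.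

Lemma reg_mx_in_span i : reg i \in reg_span.
Proof. by rewrite -(monomial1 reg) monomial_in_span. Qed.

Fact reg_span_is_aspace : is_aspace reg_span.
Proof.
rewrite /is_aspace has_algid1 ?reg_span1 //=.
by apply/prodvP=> M M'; apply: reg_span_mul.
Qed.

Definition reg_aspace : {aspace 'M[R]_N} := ASpace reg_span_is_aspace.
Definition reg_alg : falgType R := subvs_of reg_aspace.
(** A named inclusion, to carry the scaling law [idfun \; *:%R] that [one_vector_basis] asks for. *)
Definition reg_val (x : reg_alg) : 'M[R]_N := vsval x.
Definition reg_gen i : reg_alg := Subvs (reg_mx_in_span i : _ \in reg_aspace).

Fact reg_val_is_zmod_morphism : zmod_morphism reg_val.
Proof. by []. Qed.
Fact reg_val_is_scalable : scalable_for (idfun \; *:%R) reg_val.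
Proof. by []. Qed.
Fact reg_val_is_monoid_morphism : monoid_morphism reg_val.
Proof.
(* The unit of a subalgebra is its own [algid], which is the identity matrix because the span
   contains 1. *)
split=> //; apply/eqP; rewrite /reg_val /= (algid_eq1 reg_aspace).
exact: reg_span1.
Qed.

HB.instance Definition _ :=
  GRing.isZmodMorphism.Build reg_alg 'M[R]_N reg_val reg_val_is_zmod_morphism.
HB.instance Definition _ :=
  GRing.isScalable.Build R reg_alg 'M[R]_N (idfun \; *:%R) reg_val
    reg_val_is_scalable.
HB.instance Definition _ :=
  GRing.isMonoidMorphism.Build reg_alg 'M[R]_N reg_val
    reg_val_is_monoid_morphism.

Lemma reg_val_inj : injective reg_val.
Proof. exact: subvs_inj. Qed.

Lemma reg_val_span x : reg_val x \in reg_span.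
Proof. exact: subvsP. Qed.

Lemma reg_gen_clifford : clifford_relations reg_gen.
Proof.
have [sqr_reg anti_reg] := reg_mx_clifford R p q.
split=> [i|i j ij]; apply: reg_val_inj.
  rewrite rmorphM /= [LHS]sqr_reg; case: ifP => _; first by rewrite rmorph1.
  by rewrite rmorphN1.
by rewrite rmorphN rmorphM [LHS]anti_reg // rmorphM.
Qed.

Lemma reg_val_monomial S : reg_val (monomial reg_gen S) = monomial reg S.
Proof. by rewrite /monomial rmorph_prod. Qed.

Lemma reg_alg_eq x :
  x = \sum_S reg_val x (set_index S) (set_index set0) *: monomial reg_gen S.
Proof.
apply: reg_val_inj; rewrite [LHS](reg_span_eq (reg_val_span x)) raddf_sum.
by apply: eq_bigr => S _; rewrite -reg_val_monomial.
Qed.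

(** * Universal property: extension of a map on generators *)

Section Lift.
Variables (B : algType R) (w : 'I_n -> B).

(** Reading coefficients off the column at [set0] makes this linear on all matrices;
    multiplicativity is proved on the span. *)
Definition lift_span (M : 'M[R]_N) : B :=
  \sum_S M (set_index S) (set_index set0) *: monomial w S.

Fact lift_span_is_linear : linear lift_span.
Proof.
move=> a M M'; rewrite /lift_span scaler_sumr -big_split; apply: eq_bigr => S _.
by rewrite !mxE scalerDl scalerA.
Qed.

HB.instance Definition _ :=
  GRing.isLinear.Build R 'M[R]_N B *:%R lift_span lift_span_is_linear.

Lemma lift_span_monomial S : lift_span (monomial reg S) = monomial w S.
Proof.
rewrite /lift_span (bigD1 S) //= big1 => [|T TS].
  by rewrite monomial_reg_entry eqxx scale1r addr0.
by rewrite monomial_reg_entry (negbTE TS) scale0r.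
Qed.

Hypothesis w_clifford : clifford_relations w.

(** On monomials, both sides obey [mul_monomial] with the same sign. *)
Lemma lift_span_gen i M : M \in reg_span ->
  lift_span (reg i * M) = w i * lift_span M.
Proof.
move: M; apply: reg_span_ind => [|M M' IH IH'|a M IH|S].
- by rewrite mulr0 linear0 mulr0.
- by rewrite mulrDr !linearD mulrDr /= IH IH'.
- by rewrite -scalerAr !linearZ /= IH scalerAr.
rewrite mul_monomial; last exact: reg_mx_clifford.
rewrite lift_span_monomial mul_monomial // !mulr_sign.
by case: ifP; rewrite ?linearN /= lift_span_monomial.
Qed.

Lemma lift_span_mul M M' : M \in reg_span -> M' \in reg_span ->
  lift_span (M * M') = lift_span M * lift_span M'.
Proof.
move=> + M'U; move: M; apply: reg_span_ind => [|M1 M2 IH1 IH2|a M IH|S].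
- by rewrite mul0r linear0 mul0r.
- by rewrite mulrDl !linearD mulrDl /= IH1 IH2.
- by rewrite -scalerAl !linearZ /= IH scalerAl.
rewrite lift_span_monomial /monomial.
(* Membership in the span is carried through the induction because [lift_span_gen] requires it at
   each factor. *)
suff [] : \prod_(i < n | i \in S) reg i * M' \in reg_span /\
    lift_span (\prod_(i < n | i \in S) reg i * M') =
      \prod_(i < n | i \in S) w i * lift_span M' by [].
elim/big_rec2: _ => [|i y M _ [MU IH]]; first by rewrite !mul1r.
by rewrite -!mulrA mul_reg_span // lift_span_gen // IH.
Qed.

Definition lift (x : reg_alg) : B := lift_span (reg_val x).

Fact lift_is_linear : linear lift.
Proof.
by move=> a x y; exact: (lift_span_is_linear a (reg_val x) (reg_val y)).
Qed.
Fact lift_is_monoid_morphism : monoid_morphism lift.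
Proof.
split=> [|x y]; rewrite /lift.
  by rewrite rmorph1 -(monomial0 reg) lift_span_monomial monomial0.
by rewrite rmorphM [LHS]lift_span_mul ?reg_val_span.
Qed.

Lemma lift_gen i : lift (reg_gen i) = w i.
Proof.
by rewrite /lift -[reg_val _](monomial1 reg) lift_span_monomial monomial1.
Qed.

Lemma lift_unique (g : {lrmorphism reg_alg -> B}) :
  (forall i, g (reg_gen i) = w i) -> g =1 lift.
Proof.
move=> gw x; rewrite [in LHS](reg_alg_eq x) linear_sum; apply: eq_bigr => S _.
rewrite linearZ /= /monomial rmorph_prod; congr (_ *: _).
by apply: eq_bigr => i _; apply: gw.
Qed.
End Lift.

(** * Identification with the Clifford algebra and with the generated algebra *)

Lemma reg_alg_clifford : is_clifford_algebra reg_gen.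
Proof.
split=> [||B w w_clifford]; first exact: reg_gen_clifford.
  by rewrite dimvf; apply: dim_reg_span.
pose f : {lrmorphism reg_alg -> B} := HB.pack (lift w)
  (GRing.isLinear.Build R reg_alg B *:%R (lift w) (lift_is_linear w))
  (GRing.isMonoidMorphism.Build reg_alg B (lift w)
     (lift_is_monoid_morphism w_clifford)).
by exists f; split=> [|g]; [apply: lift_gen | apply: lift_unique].
Qed.

Lemma generated_reg_span M :
  generated_real_algebra idfun reg M <-> M \in reg_span.
Proof.
split=> [|].
  elim=> [|i|a M' _ MU|M1 M2 _ MU1 _ MU2|M1 M2 _ MU1 _ MU2].
  - exact: reg_span1.
  - exact: reg_mx_in_span.
  - exact: memvZ.
  - exact: memvD.
  exact: reg_span_mul.
move: M; apply: reg_span_ind => [|M M' ? ?|a M ?|S].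
(* Zero is generated as the scalar 0 times the identity. *)
- by rewrite -[0](scale0r 1); apply: (GenScale 0); apply: GenOne.
- exact: GenAdd.
- exact: (GenScale a).
rewrite /monomial; elim/big_rec: _ => [|i M _ ?]; first exact: GenOne.
by apply: GenMul => //; apply: GenVar.
Qed.

Lemma reg_mx_one_vector_basis : one_vector_basis idfun reg.
Proof.
split; first exact: reg_mx_clifford.
exists reg_alg, reg_gen, reg_val; split=> //; first exact: reg_alg_clifford.
  exact: reg_val_inj.
move=> M; rewrite generated_reg_span; split=> [MU|[x <-]];
  last exact: reg_val_span.
by exists (Subvs (MU : M \in reg_aspace)).
Qed.
End RegularAlgebra.

Theorem theorem35 (R : realType) (p q : nat) :
  exists m : nat,
    [\/ exists B : 'I_(p + q) -> 'M[R]_m.+1,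
          [/\ one_vector_basis idfun B,
              forall i, adjmx id (B i) = B i \/ adjmx id (B i) = - B i &
              forall i j, B i <> B j -> \tr (adjmx id (B i) *m B j) = 0],
        exists B : 'I_(p + q) -> 'M[R[i]]_m.+1,
          [/\ one_vector_basis (real_complex R) B,
              forall i, adjmx conjc (B i) = B i \/ adjmx conjc (B i) = - B i &
              forall i j, B i <> B j -> \tr (adjmx conjc (B i) *m B j) = 0] |
        exists B : 'I_(p + q) -> 'M[quaternion R]_m.+1,
          [/\ one_vector_basis (@real_quaternion R) B,
              exists i k l, ~~ complex_quaternion (B i k l),
              forall i, adjmx (@conjq R) (B i) = B i \/
                        adjmx (@conjq R) (B i) = - B i &
              forall i j, B i <> B j ->
                qre (\tr (adjmx (@conjq R) (B i) *m B j)) = 0]].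
Proof.
(* The real alternative holds for all [p] and [q]. *)
exists (reg_size p q); apply: Or31; exists (@reg_mx R p q).
have adj_id m (M : 'M[R]_m) : adjmx id M = M^T by apply: map_mx_id.
split=> [|i|i j neq_ij]; rewrite ?adj_id.
- exact: reg_mx_one_vector_basis.
- by rewrite reg_mx_tr scaler_sign; case: ifP => _; [right | left].
- by apply: reg_mx_trace; apply: contra_notN neq_ij => /eqP->.
Qed.
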